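(* In the binary model, suppose $\lambda\in(g,1)$, where $g=\frac{\sqrt5-1}{2}$. Then almost surely $S=\mathrm{supp}(\mu)$ has nonempty interior and is the closure of its interior.
   Context: Binary model. Let $T=\{1,2\}^*$ be the set of finite words over $\{1,2\}$ (the rooted binary tree; $v|j$ is the prefix of $v$ of length $j$). Let $\{a_v\}_{v\in T,\,|v|\ge1}$ be i.i.d. random variables with $\mathbb{P}(a_v=0)=\mathbb{P}(a_v=1)=\frac12$. Fix $\lambda\in(0,1)$. For $\omega\in\{1,2\}^{\mathbb{N}}$ put $f(\omega)=\sum_{j\ge1}a_{\omega|j}\lambda^j$. Let $\mu$ be the image under $f$ of the uniform product measure on $\{1,2\}^{\mathbb{N}}$, and $S=f(\{1,2\}^{\mathbb{N}})$ its (random, compact) support. *)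

(* Defs.v *)
From HB Require Import structures.
From mathcomp Require Import all_boot all_order all_algebra.
From mathcomp Require Import all_classical all_reals all_analysis.
Set Implicit Arguments. Unset Strict Implicit. Unset Printing Implicit Defensive.
Import Order.TTheory GRing.Theory Num.Theory.
Import numFieldNormedType.Exports.
Local Open Scope classical_set_scope.
Local Open Scope ring_scope.

(* Binary model.  Words over {1,2} are encoded as [seq bool]
   (false <-> 1, true <-> 2); infinite words omega in {1,2}^N as
   [nat -> bool] (omega 0 is the first letter). *)

Definition prefix (omega : nat -> bool) (j : nat) : seq bool :=
  [seq omega i | i <- iota 0 j].

Definition iid_fair_labels d (T : measurableType d) (R : realType)
    (P : probability T R) (a : seq bool -> T -> bool) : Prop :=
  (forall v, measurable (a v @^-1` [set true])) /\
  forall (s : seq (seq bool)) (b : seq bool -> bool),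
    uniq s -> all (fun v => (0 < size v)%N) s ->
    P (\bigcap_(v in [set` s]) [set t | a v t = b v]) = ((1/2 : R) ^+ size s)%:E.

Definition fbin (R : realType) (T : Type) (a : seq bool -> T -> bool)
    (lambda : R) (t : T) (omega : nat -> bool) : R :=
  limn (series (fun j : nat => (a (prefix omega j.+1) t)%:R * lambda ^+ j.+1)).

Definition Sbin (R : realType) (T : Type) (a : seq bool -> T -> bool)
    (lambda : R) (t : T) : set R :=
  range (fbin a lambda t).

(* Main.v *)
Require Import Defs.
From HB Require Import structures.
From mathcomp Require Import all_boot all_order all_algebra.
From mathcomp Require Import all_classical all_reals all_analysis.
From mathcomp Require Import ring lra.
Set Implicit Arguments.
Unset Strict Implicit.
Unset Printing Implicit Defensive.
Import Order.TTheory GRing.Theory Num.Theory.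
Import numFieldNormedType.Exports.
Local Open Scope classical_set_scope.
Local Open Scope ring_scope.

(* Put [max_sum = lambda / (1 - lambda)].  A node [v] of the tree sees a point
   [x] through its residual [r = (x - word_sum v) / lambda ^ |v|], which has to
   lie in [[0, max_sum]]; a child labelled [c] has residual [r / lambda - c].
   Above the golden mean [1 + lambda < max_sum], and a tent truncated slightly
   above [lambda] is then a weight whose expected sum over the two children
   exceeds that of the parent by a factor larger than [1]; this even holds with
   the children weighted by [inner_weight], which is below [weight] uniformly on
   a [margin]-neighbourhood.  Given the labels up to level [n], the total inner
   weight of level [n + 1] at [x] is a sum of independent bounded terms, so that
   by a Chernoff bound it fails to grow with a probability exponentially small
   in the total weight of level [n].  With geometrically growing thresholds
   these probabilities are summable over grids of [O(2 ^ n)] points, and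
   Borel-Cantelli leaves no failure from some level [m] on.  Since [2 * lambda]
   exceeds the growth rate, averaging yields a point whose total weight at level
   [m] is above the threshold; around it the weights stay positive at all later
   levels on an interval, which is therefore contained in the compact set [S].
   Applied to all subtrees, this gives interior points in every cylinder of [S],
   hence the second claim. *)

(** * Sums, powers and measures *)

Lemma exists_ge_average (R : realFieldType) (I : finType) (F : I -> R) (c : R) :
  (0 < #|I|)%N -> c * #|I|%:R <= \sum_i F i -> exists i, c <= F i.
Proof.
move=> I_gt0 le_sum; have /card_gt0P[i0 _] := I_gt0.
have [i _ F_max] := @arg_maxP _ _ _ i0 xpredT F isT.
exists i; rewrite -(@ler_pM2r _ #|I|%:R) ?ltr0n // (le_trans le_sum) //.
by rewrite mulr_natr -sumr_const ler_sum // => j _; exact: F_max.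
Qed.

Lemma sum_tuple_rcons (V : nmodType) (I : finType) n (F : seq I -> V) :
  \sum_(v : n.+1.-tuple I) F v =
  \sum_(p : n.-tuple I * I) F (rcons p.1 p.2).
Proof.
pose f (p : n.-tuple I * I) := [tuple of rcons p.1 p.2].
suff f_bij : bijective f by rewrite (reindex f) //; exact: onW_bij.
apply: inj_card_bij; last by rewrite card_prod !card_tuple expnSr.
by move=> [v i] [w j] /(congr1 val) /= /rcons_inj[/val_inj -> ->].
Qed.

Lemma exists_mul_expr_lt (R : archiRealFieldType) (q C e : R) :
  `|q| < 1 -> 0 < e -> exists n, C * q ^+ n < e.
Proof.
move=> q_lt1 e_gt0.
have /cvgrPdist_lt/(_ e e_gt0)[n _] := cvg_geometric C q_lt1.
move=> /(_ n (leqnn n)); rewrite /= sub0r normrN => lt_e.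
by exists n; exact: le_lt_trans (ler_norm _) lt_e.
Qed.

Lemma expr_mul_expR_bounded (R : realType) (M q c : R) :
  0 <= M -> 1 < q -> 0 < c ->
  exists C, forall n, M ^+ n * expR (- (c * q ^+ n)) <= C.
Proof.
move=> M_ge0 q_gt1 c_gt0; have q_gt0 : 0 < q by rewrite (lt_trans _ q_gt1).
have [|k] := @exists_mul_expr_lt _ q^-1 M 1 _ ltr01.
  by rewrite gtr0_norm ?invr_gt0 // invf_lt1.
rewrite exprVn ltr_pdivrMr ?exprn_gt0 // mul1r => M_lt.
have M_le : M <= q ^+ k.+1.
  by rewrite (le_trans (ltW M_lt)) // ler_weXn2l // ltW.
exists ((k.+1)`!%:R / c ^+ k.+1) => n.
rewrite expRN ler_pdivrMr ?expR_gt0 // mulrAC ler_pdivlMr ?exprn_gt0 //.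
have := expR_ge1Dxn k (mulr_ge0 (ltW c_gt0) (exprn_ge0 n (ltW q_gt0))).
rewrite -lerBrDl ler_pdivrMr ?ltr0n ?fact_gt0 // => pow_le.
apply: (@le_trans _ _ ((c * q ^+ n) ^+ k.+1)).
  rewrite exprMn mulrC ler_pM2l ?exprn_gt0 // exprAC.
  by rewrite lerXn2r ?nnegrE ?exprn_ge0 ?(ltW q_gt0).
apply: le_trans pow_le _; rewrite mulrC ler_wpM2l ?ler0n //.
by rewrite lerBlDr lerDl.
Qed.

Section Grid.
Variable R : archiRealFieldType.
Implicit Types e x y : R.

Definition grid_floor e x : R := (Num.truncn (x / e))%:R * e.

Lemma grid_floor_itv e x : 0 < e -> 0 <= x ->
  grid_floor e x <= x < grid_floor e x + e.
Proof.
move=> e_gt0 x_ge0; have : 0 <= x / e by rewrite divr_ge0 // ltW.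
move=> /truncn_itv/andP[trunc_le].
rewrite -natr1 ltr_pdivrMr // mulrDl mul1r => ->.
by rewrite -ler_pdivlMr // trunc_le.
Qed.

Lemma grid_floor_refine k e x y : (0 < k)%N -> 0 < e -> 0 <= x ->
  grid_floor (k%:R * e) y <= x -> grid_floor (k%:R * e) y <= grid_floor e x.
Proof.
move=> k_gt0 e_gt0 x_ge0; rewrite /grid_floor mulrA -natrM => le_x.
rewrite ler_pM2r // ler_nat truncn_ge_nat ?divr_ge0 ?(ltW e_gt0) //.
by rewrite ler_pdivlMr.
Qed.

End Grid.

Lemma measure_bigsetU_le d (T : ringOfSetsType d) (R : realFieldType)
    (mu : {content set T -> \bar R}) (J : Type) (r : seq J) (Q : pred J)
    (F : J -> set T) : (forall j, measurable (F j)) ->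
  (mu (\big[setU/set0]_(j <- r | Q j) F j) <= \sum_(j <- r | Q j) mu (F j))%E.
Proof.
move=> mF; elim: r => [|j r IH]; first by rewrite !big_nil measure0.
rewrite !big_cons; case: ifP => // _; apply: le_trans (measureU2 _ _ _) _ => //.
  exact: bigsetU_measurable.
by rewrite leeD2l.
Qed.

Lemma ae_forall_countable d (T : measurableType d) (R : realType)
    (mu : {measure set T -> \bar R}) (I : countType) (Q : I -> T -> Prop) :
  (forall i, {ae mu, forall t, Q i t}) -> {ae mu, forall t, forall i, Q i t}.
Proof.
move=> Q_ae; have : \forall t \ae mu, forall n,
    if unpickle n is Some i then Q i t else True.
  apply: ae_foralln => n; case: (unpickle n) => [i|]; first exact: Q_ae.
  exact: filterT.
by apply: filterS => t Qt i; have := Qt (pickle i); rewrite pickleK.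
Qed.

(** * Lower tails for independent fair bits *)

Section LowerTail.
Variable R : realType.

(* Markov's inequality for [expR (- s * sum)] under the uniform measure. *)
Lemma card_sum_lt_le (J K : finType) (g : J -> K -> R) (s theta : R) : 0 <= s ->
  #|[pred f : {ffun J -> K} | \sum_j g j (f j) < theta]|%:R <=
  expR (s * theta) * \prod_j \sum_k expR (- (s * g j k)).
Proof.
move=> s_ge0; rewrite bigA_distr_bigA mulr_sumr -sum1_card natr_sum.
rewrite big_mkcond /=.
apply: ler_sum => f _; rewrite inE -expR_sum -expRD sumrN -mulr_sumr -mulrBr.
case: ltP => [lt_theta|_]; last exact: expR_ge0.
by rewrite -expR0 ler_expR mulr_ge0 // subr_ge0 ltW.
Qed.

Lemma expRN_le_affine (s y : R) : 0 <= s <= 1 -> 0 <= y <= 1 ->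
  expR (- (s * y)) <= 1 - (s - s ^+ 2) * y.
Proof.
move=> /andP[s_ge0 s_le1] /andP[y_ge0 y_le1].
have sy_ge0 : 0 <= s * y by rewrite mulr_ge0.
apply: (@le_trans _ _ (1 + s * y)^-1).
  by rewrite expRN lef_pV2 ?posrE ?expR_gt0 ?expR_ge1Dx //; lra.
rewrite -[leLHS]mul1r ler_pdivrMr; last lra.
have yy_le : y * y <= y by nra.
have : s * s * (y * y) <= s * s * y by rewrite ler_wpM2l ?mulr_ge0.
have : 0 <= s * s * s * (y * y) by rewrite !mulr_ge0.
by rewrite expr2; nra.
Qed.

Definition uniform_mean (J K : finType) (g : J -> K -> R) : R :=
  \sum_j (\sum_k g j k) / #|K|%:R.

Lemma card_chernoff (J K : finType) (g : J -> K -> R) (tau : R) :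
    (0 < #|K|)%N -> 0 <= tau <= 1 -> (forall j k, 0 <= g j k <= 1) ->
  #|[pred f : {ffun J -> K} |
     \sum_j g j (f j) < (1 - tau) * uniform_mean g]|%:R <=
  expR (- (tau ^+ 2 / 4 * uniform_mean g)) * #|K|%:R ^+ #|J|.
Proof.
move=> K_gt0 /andP[tau_ge0 tau_le1] g01; set mean := uniform_mean g.
have cardK_gt0 : 0 < #|K|%:R :> R by rewrite ltr0n.
pose s := tau / 2; have s01 : 0 <= s <= 1 by apply/andP; rewrite /s; split; lra.
apply: le_trans (card_sum_lt_le _ _ (_ : 0 <= s)) _; first by case/andP: s01.
have factor_le j : \sum_k expR (- (s * g j k)) <=
    #|K|%:R * expR (- ((s - s ^+ 2) * ((\sum_k g j k) / #|K|%:R))).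
  apply: (@le_trans _ _ (\sum_k (1 - (s - s ^+ 2) * g j k))).
    by apply: ler_sum => k _; exact: expRN_le_affine.
  rewrite big_split sumr_const sumrN -mulr_sumr /=.
  apply: le_trans (ler_wpM2l (ltW cardK_gt0) (expR_ge1Dx _)).
  rewrite mulrDr mulr1 mulrN mulrCA (mulrCA _ (\sum_k _)).
  by rewrite divff ?gt_eqF // mulr1.
apply: (@le_trans _ _ (expR (s * ((1 - tau) * mean)) *
    (#|K|%:R ^+ #|J| * expR (- ((s - s ^+ 2) * mean))))).
  rewrite ler_wpM2l ?expR_ge0 // mulr_sumr -sumrN expR_sum -prodr_const.
  rewrite -big_split /=; apply: ler_prod => j _.
  by rewrite factor_le sumr_ge0 // => k _; exact: expR_ge0.
rewrite mulrCA mulrC -expRD ler_pM2r ?exprn_gt0 // ler_expR.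
by rewrite /s !expr2; nra.
Qed.

End LowerTail.

Section FairBits.
Variables (d : measure_display) (T : measurableType d) (R : realType).
Variables (P : probability T R).
Variables (I : choiceType) (D : pred I) (a : I -> T -> bool).

Definition fair_bits : Prop :=
  (forall i, measurable (a i @^-1` [set true])) /\
  forall (s : seq I) (b : I -> bool), uniq s -> all D s ->
    P (\bigcap_(i in [set` s]) [set t | a i t = b i]) =
    ((1 / 2 : R) ^+ size s)%:E.

Definition outcome (J : finType) (w : J -> I) (t : T) : {ffun J -> bool} :=
  [ffun j => a (w j) t].

Definition extend (J : finType) (w : J -> I) (f : {ffun J -> bool}) :
    I -> bool :=
  fun i => [exists j, (w j == i) && f j].

Lemma extendE (J : finType) (w : J -> I) f j :
  injective w -> extend w f (w j) = f j.
Proof.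
move=> w_inj; apply/existsP/idP => [[k /andP[/eqP/w_inj ->]] //|fj].
by exists j; rewrite eqxx.
Qed.

Hypothesis fair : fair_bits.

Lemma measurable_bit i c : measurable [set t | a i t = c].
Proof.
case: c; first exact: fair.1.
rewrite (_ : [set t | _] = ~` (a i @^-1` [set true])).
  by apply: measurableC; exact: fair.1.
by apply/seteqP; split=> t /=; case: (a i t).
Qed.

Section Outcome.
Variables (J : finType) (w : J -> I).

Lemma measurable_outcome (A : set {ffun J -> bool}) :
  measurable (outcome w @^-1` A).
Proof.
rewrite (_ : _ @^-1` A =
    \bigcup_(f in A) \bigcap_(j in [set: J]) [set t | a (w j) t = f j]).
  apply: fin_bigcup_measurable => // f _.
  by apply: fin_bigcap_measurable => // j _; exact: measurable_bit.
apply/seteqP; split=> [t At|t [f Af tf]] /=.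
  by exists (outcome w t) => // j _; rewrite /= ffunE.
by rewrite (_ : outcome w t = f) //; apply/ffunP => j; rewrite ffunE; exact: tf.
Qed.

Lemma prob_outcome (f : {ffun J -> bool}) :
  injective w -> (forall j, D (w j)) ->
  P (outcome w @^-1` [set f]) = ((1 / 2) ^+ #|J|)%:E.
Proof.
move=> w_inj wD; rewrite -(size_codom w) -(fair.2 (codom w) (extend w f)).
- congr (P _); apply/seteqP; split=> t /=.
    by move=> <- i /= /codomP[j ->]; rewrite extendE // ffunE.
  move=> tf; apply/ffunP => j; rewrite ffunE -(extendE f j w_inj).
  by apply: tf; exact: codom_f.
- by rewrite map_inj_uniq ?enum_uniq.
- by apply/allP => i /codomP[j ->]; exact: wD.
Qed.

End Outcome.

Lemma measurable_outcome_pair (J1 J2 : finType) (w1 : J1 -> I) (w2 : J2 -> I)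
    (Q : {ffun J1 -> bool} -> {ffun J2 -> bool} -> Prop) :
  measurable [set t | Q (outcome w1 t) (outcome w2 t)].
Proof.
pose w (j : J1 + J2) := match j with inl j1 => w1 j1 | inr j2 => w2 j2 end.
have wE t : (outcome w1 t = [ffun j => outcome w t (inl j)]) /\
    (outcome w2 t = [ffun j => outcome w t (inr j)]).
  by split; apply/ffunP => j; rewrite !ffunE.
rewrite (_ : [set t | _] = outcome w @^-1`
    [set f | Q [ffun j => f (inl j)] [ffun j => f (inr j)]]).
  exact: measurable_outcome.
by apply/seteqP; split=> t /=; case: (wE t) => -> ->.
Qed.

(* Total probability over the bits [w (inl _)]. *)
Lemma prob_conditional_le (J1 J2 : finType) (w : J1 + J2 -> I)
    (A : {ffun J1 -> bool} -> pred {ffun J2 -> bool}) (p : R) :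
    injective w -> (forall j, D (w j)) ->
    (forall f, #|A f|%:R <= p * 2 ^+ #|J2|) ->
  (P [set t | A (outcome (w \o inl) t) (outcome (w \o inr) t)] <= p%:E)%E.
Proof.
move=> w_inj wD A_le.
pose merge (f : {ffun J1 -> bool} * {ffun J2 -> bool}) :
    {ffun J1 + J2 -> bool} :=
  [ffun j => match j with inl j1 => f.1 j1 | inr j2 => f.2 j2 end].
have mergeP t f : outcome w t = merge f <->
    f = (outcome (w \o inl) t, outcome (w \o inr) t).
  split=> [/ffunP tf|->]; last by apply/ffunP => -[j|j]; rewrite !ffunE.
  case: f tf => f1 f2 tf; congr (_, _); apply/ffunP => j.
    by have := tf (inl j); rewrite !ffunE.
  by have := tf (inr j); rewrite !ffunE.
rewrite (_ : [set t | _] = \big[setU/set0]_(f | A f.1 f.2)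
    (outcome w @^-1` [set merge f])); last first.
  rewrite -bigcup_seq_cond; apply/seteqP; split=> [t tA|t [f]] /=.
    exists (outcome (w \o inl) t, outcome (w \o inr) t); last exact/mergeP.
    by rewrite /= mem_index_enum.
  by move=> /andP[_ fA] /mergeP fE; rewrite fE in fA.
apply: le_trans (measure_bigsetU_le _ _ _ _) _ => [f|].
  exact: measurable_outcome.
rewrite (eq_bigr _ (fun f _ => prob_outcome (merge f) w_inj wD)).
rewrite sumEFin lee_fin -(pair_big_dep xpredT (fun f g => A f g)
  (fun _ _ => (1 / 2) ^+ #|{: J1 + J2}|)) /=.
apply: (@le_trans _ _ (\sum_(f : {ffun J1 -> bool}) p * (1 / 2) ^+ #|J1|)).
  apply: ler_sum => f _; rewrite sumr_const card_sum -[leLHS]mulr_natl exprD.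
  rewrite mulrCA [leRHS]mulrC ler_pM2l ?exprn_gt0 //.
  by rewrite expr_div_n expr1n mul1r ler_pdivrMr ?exprn_gt0.
rewrite sumr_const card_ffun card_bool -[leLHS]mulr_natl natrX mulrCA -exprMn.
by rewrite mul1r divff // expr1n mulr1.
Qed.

End FairBits.

(** * A weight growing under the two inverse branches *)

Section Weight.
Variables (R : realFieldType) (lam : R).

Definition max_sum : R := lam / (1 - lam).

Definition slack : R := Num.min (1 - lam) (max_sum - 1 - lam) / 4.

Definition margin : R := slack ^+ 2 / 16.

Definition tent (x : R) : R :=
  Num.min (Num.min x (max_sum - x)) (lam + 2 * slack).

Definition clipped_tent (e x : R) : R := Num.max 0 (tent x - e).

Definition weight : R -> R := clipped_tent (slack / 4).

Definition inner_weight : R -> R := clipped_tent (slack / 4 + margin).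

Lemma le_tent x y :
  (y <= tent x) = [&& y <= x, y <= max_sum - x & y <= lam + 2 * slack].
Proof. by rewrite /tent !le_min andbA. Qed.

Lemma tent_le x :
  [/\ tent x <= x, tent x <= max_sum - x & tent x <= lam + 2 * slack].
Proof. by have := lexx (tent x); rewrite {1}le_tent => /and3P[]. Qed.

Lemma tent_le_dist x y : tent x <= tent y + `|x - y|.
Proof.
have [? ? ?] := tent_le x.
have := ler_norm (x - y); have := ler_norm (y - x); rewrite distrC => ? ?.
by rewrite -lerBlDr le_tent; apply/and3P; split; lra.
Qed.

Lemma tent_sym x : tent (max_sum - x) = tent x.
Proof. by rewrite /tent subKr (minC (_ - _)). Qed.

Lemma clipped_tent_sym e x : clipped_tent e (max_sum - x) = clipped_tent e x.
Proof. by rewrite /clipped_tent tent_sym. Qed.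

Lemma clipped_tent_ge0 e x : 0 <= clipped_tent e x.
Proof. by rewrite le_max lexx. Qed.

Lemma le_clipped_tent e x y : y + e <= tent x -> y <= clipped_tent e x.
Proof. by rewrite le_max lerBrDr orbC => ->. Qed.

Lemma inner_weight_le x y : `|x - y| <= margin -> inner_weight x <= weight y.
Proof.
move=> xy; have := tent_le_dist x y.
rewrite ge_max clipped_tent_ge0 le_max /= => ?; apply/orP; right; lra.
Qed.

Hypotheses (lam_gt0 : 0 < lam) (lam_lt1 : lam < 1).
Hypothesis golden : 1 < lam + lam ^+ 2.

Lemma max_sumE : max_sum = max_sum * lam + lam.
Proof. by rewrite /max_sum; field; rewrite subr_eq0 gt_eqF. Qed.

Lemma max_sum_gt0 : 0 < max_sum.
Proof. by rewrite divr_gt0 // subr_gt0. Qed.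

Lemma max_sum_gt : 1 + lam < max_sum.
Proof.
by rewrite ltr_pdivlMr ?subr_gt0 //; move: golden; rewrite expr2; lra.
Qed.

Lemma slack_gt0 : 0 < slack.
Proof.
have := max_sum_gt; have := lam_lt1 => *.
by rewrite divr_gt0 // lt_min; apply/andP; split; lra.
Qed.

Lemma lam_gt_half : 1 / 2 < lam.
Proof. by have := lam_gt0; have := golden; rewrite expr2; nra. Qed.

Lemma slack_bounds : [/\ slack < 1 / 8, lam + 4 * slack <= 1 &
  lam + 4 * slack <= max_sum - 1].
Proof.
have := lam_gt_half; rewrite /slack; set s := Num.min _ _ => ?.
have /andP[? ?] : (s <= 1 - lam) && (s <= max_sum - 1 - lam) by rewrite -le_min.
by split; lra.
Qed.

Lemma margin_gt0 : 0 < margin.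
Proof. by rewrite divr_gt0 // exprn_gt0 // slack_gt0. Qed.

Lemma margin_lt : margin < slack / 128.
Proof.
have [slack_lt _ _] := slack_bounds.
have : slack * slack < slack * (1 / 8) by rewrite ltr_pM2l // slack_gt0.
by rewrite /margin expr2; lra.
Qed.

Lemma inner_weight_bounds x : 0 <= inner_weight x <= 1.
Proof.
rewrite clipped_tent_ge0 /= ge_max ler01 /=.
have [_ _ ?] := tent_le x; have [_ ? _] := slack_bounds.
by have := slack_gt0; have := margin_gt0; lra.
Qed.

Lemma weight_gt0_bounds x : 0 < weight x -> 0 <= x <= max_sum.
Proof.
rewrite lt_max ltxx /= subr_gt0; have [? ? _] := tent_le x.
by have := slack_gt0; lra.
Qed.

Lemma inner_weight_center x :
  `|x - max_sum / 2| <= 1 / 4 -> 1 / 4 <= inner_weight x.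
Proof.
rewrite ler_norml => /andP[? ?]; apply: le_clipped_tent; rewrite le_tent.
have [? _ _] := slack_bounds; have := slack_gt0.
have := lam_gt_half; have := margin_lt; have := max_sum_gt => *.
by apply/and3P; split; lra.
Qed.

(* For small [x] the branch [x / lam] suffices: its slope [1 / lam] pays for the
   growth rate and the larger cutoff. *)
Lemma weight_growth_small x : slack / 4 < tent x -> x <= lam + slack ->
  (1 + slack / 4) * (tent x - slack / 4) <= inner_weight (x / lam).
Proof.
move=> tent_gt x_le; have [slack_lt lam_le1 lam_le_sum] := slack_bounds.
have [[slack_pos lam_pos] lam_half] := (slack_gt0, lam_gt0, lam_gt_half).
have [tent_le_x _ _] := tent_le x.
set y := x / lam; have xE : x = y * lam by rewrite /y divfK ?gt_eqF.
have y_le : y <= 1 + 2 * slack by rewrite ler_pdivrMr //; nra.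
have y_ge : x + 4 * slack * x <= y.
  have : 4 * slack * y <= (1 - lam) * y by rewrite ler_wpM2r //; nra.
  have : slack * x <= slack * y by rewrite ler_pM2l //; nra.
  lra.
have : slack * tent x <= slack * x by rewrite ler_pM2l.
have /andP[? ?] : 0 <= slack * x <= slack * 1.
  by rewrite pmulr_rge0 // ler_pM2l //; lra.
have : margin = slack * slack / 16 by rewrite /margin expr2.
by move=> *; apply: le_clipped_tent; rewrite le_tent; apply/and3P; split; lra.
Qed.

Lemma weight_growth_middle x : lam + slack < x -> x <= max_sum / 2 ->
  (1 + slack / 4) * (tent x - slack / 4) <=
  inner_weight (x / lam) + inner_weight (x / lam - 1).
Proof.
move=> x_gt x_le; have [slack_lt lam_le1 lam_le_sum] := slack_bounds.
have [[slack_pos lam_pos] sum_eq] := (slack_gt0, lam_gt0, max_sumE).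
have [margin_pos margin_small] := (margin_gt0, margin_lt).
have [_ _ tent_le_top] := tent_le x.
set y := x / lam; have y_gt : 1 + slack < y by rewrite ltr_pdivlMr //; nra.
have y_le : y <= (max_sum + 1) / 2 by rewrite ler_pdivrMr //; lra.
have slack_tent_le : slack * (tent x - slack / 4) <= slack * 1.
  by rewrite ler_pM2l //; lra.
have [y_mid|y_end] := leP (lam + 2 * slack) (max_sum - y).
  have : lam + 2 * slack - (slack / 4 + margin) <= inner_weight y.
    by apply: le_clipped_tent; rewrite subrK le_tent y_mid lexx; lra.
  have : slack - (slack / 4 + margin) <= inner_weight (y - 1).
    by apply: le_clipped_tent; rewrite subrK le_tent; apply/and3P; split; lra.
  lra.
have : max_sum - y - (slack / 4 + margin) <= inner_weight y.
  by apply: le_clipped_tent; rewrite subrK le_tent lexx; apply/andP; split; lra.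
have : y - 1 - (slack / 4 + margin) <= inner_weight (y - 1).
  by apply: le_clipped_tent; rewrite subrK le_tent lexx; apply/andP; split; lra.
lra.
Qed.

Lemma weight_growth_left x : x <= max_sum / 2 ->
  (1 + slack / 4) * weight x <=
  inner_weight (x / lam) + inner_weight (x / lam - 1).
Proof.
move=> x_le.
have inner_ge0 y : 0 <= inner_weight y := clipped_tent_ge0 _ _.
have [t_le|t_gt] := leP (tent x) (slack / 4).
  by rewrite /weight /clipped_tent max_l ?subr_le0 // mulr0 addr_ge0.
rewrite /weight /clipped_tent max_r; last by rewrite subr_ge0 ltW.
have [x_small|x_large] := leP x (lam + slack); last exact: weight_growth_middle.
by apply: ler_wpDr => //; exact: weight_growth_small.
Qed.

(* The reflection [x |-> max_sum - x] exchanges the two branches [x / lam] and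
   [x / lam - 1], so the case [x <= max_sum / 2] suffices. *)
Lemma weight_growth x :
  (1 + slack / 4) * weight x <=
  inner_weight (x / lam) + inner_weight (x / lam - 1).
Proof.
have [|x_gt] := leP x (max_sum / 2); first exact: weight_growth_left.
have branch0 : max_sum - x / lam = (max_sum - x) / lam - 1.
  by rewrite {2}max_sumE; field; rewrite gt_eqF.
have branch1 : max_sum - (x / lam - 1) = (max_sum - x) / lam.
  by rewrite {2}max_sumE; field; rewrite gt_eqF.
rewrite [leRHS]addrC /weight /inner_weight -(clipped_tent_sym _ x).
rewrite -(clipped_tent_sym _ (x / lam)) -(clipped_tent_sym _ (x / lam - 1)).
by rewrite branch0 branch1; apply: weight_growth_left; lra.
Qed.

End Weight.

(** * Total weights along the tree *)

Section WordSums.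
Variables (R : realFieldType) (lam : R).
Implicit Types (b : seq bool -> bool) (v w : seq bool).

Definition word_sum b v : R :=
  \sum_(j < size v) (b (take j.+1 v))%:R * lam ^+ j.+1.

Definition residual b (x : R) v : R := (x - word_sum b v) / lam ^+ size v.

Definition total (h : R -> R) b n (x : R) : R :=
  \sum_(v : n.-tuple bool) h (residual b x v).

Lemma eq_word_sum b b' v :
  (forall w, (0 < size w <= size v)%N -> b w = b' w) ->
  word_sum b v = word_sum b' v.
Proof.
by move=> bb'; apply: eq_bigr => j _; rewrite bb' // size_takel ltn_ord.
Qed.

Lemma eq_residual b b' x v :
  (forall w, (0 < size w <= size v)%N -> b w = b' w) ->
  residual b x v = residual b' x v.
Proof. by move=> bb'; rewrite /residual (eq_word_sum bb'). Qed.

Lemma eq_total h b b' n x :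
  (forall w, (0 < size w <= n)%N -> b w = b' w) ->
  total h b n x = total h b' n x.
Proof.
move=> bb'; apply: eq_bigr => v _; congr h; apply: eq_residual => w.
by rewrite size_tuple; exact: bb'.
Qed.

Lemma word_sum_nil b : word_sum b [::] = 0.
Proof. by rewrite /word_sum big_ord0. Qed.

Lemma word_sum_rcons b v i : word_sum b (rcons v i) =
  word_sum b v + (b (rcons v i))%:R * lam ^+ (size v).+1.
Proof.
rewrite /word_sum size_rcons big_ord_recr /=.
rewrite [take _.+1 _]take_oversize ?size_rcons //.
congr (_ + _); apply: eq_bigr => j _; congr ((b _)%:R * _).
by rewrite -cats1 takel_cat.
Qed.

Lemma word_sum_cat b v w : word_sum b (v ++ w) =
  word_sum b v + lam ^+ size v * word_sum (fun u => b (v ++ u)) w.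
Proof.
elim/last_ind: w => [|w i IH]; first by rewrite cats0 word_sum_nil mulr0 addr0.
rewrite -rcons_cat !word_sum_rcons IH rcons_cat size_cat mulrDr addrA.
by rewrite -addnS exprD; congr (_ + _); rewrite mulrCA.
Qed.

Hypotheses (lam_gt0 : 0 < lam) (lam_lt1 : lam < 1).

Lemma residual_rcons b x v i :
  residual b x (rcons v i) = residual b x v / lam - (b (rcons v i))%:R.
Proof.
rewrite /residual word_sum_rcons size_rcons exprS.
by field; rewrite expf_neq0 ?gt_eqF.
Qed.

Lemma total_rcons h b n x : total h b n.+1 x =
  \sum_(p : n.-tuple bool * bool)
    h (residual b x p.1 / lam - (b (rcons p.1 p.2))%:R).
Proof.
rewrite /total (sum_tuple_rcons n (fun v => h (residual b x v))).
by apply: eq_bigr => p _; rewrite residual_rcons.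
Qed.

Lemma word_sum_ge0 b v : 0 <= word_sum b v.
Proof. by apply: sumr_ge0 => j _; rewrite mulr_ge0 // exprn_ge0 // ltW. Qed.

Lemma word_sum_tail_le b v :
  word_sum b v + max_sum lam * lam ^+ size v <= max_sum lam.
Proof.
elim/last_ind: v => [|v i IH]; first by rewrite word_sum_nil expr0 mulr1 add0r.
rewrite (le_trans _ IH) // word_sum_rcons size_rcons -addrA lerD2l.
have -> : max_sum lam * lam ^+ size v =
    1 * lam ^+ (size v).+1 + max_sum lam * lam ^+ (size v).+1.
  by rewrite {1}max_sumE // exprS; ring.
by rewrite lerD2r ler_pM2r ?exprn_gt0 // lern1 leq_b1.
Qed.

Lemma word_sum_le b v : word_sum b v <= max_sum lam.
Proof.
have pow_gt0 : 0 < lam ^+ size v by rewrite exprn_gt0.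
have max_sum_gt0 := max_sum_gt0 lam_gt0 lam_lt1.
apply: le_trans (word_sum_tail_le b v).
by rewrite lerDl ltW // mulr_gt0.
Qed.

Lemma residualK b x v : word_sum b v + residual b x v * lam ^+ size v = x.
Proof. by rewrite divfK ?expf_neq0 ?gt_eqF // addrC subrK. Qed.

Lemma residual_affine b r v :
  residual b (word_sum b v + r * lam ^+ size v) v = r.
Proof. by rewrite /residual addrC addKr mulfK ?expf_neq0 ?gt_eqF. Qed.

Lemma residual_bounds b x v :
  0 <= residual b x v <= max_sum lam -> 0 <= x <= max_sum lam.
Proof.
have pow_gt0 : 0 < lam ^+ size v by rewrite exprn_gt0.
move=> /andP[r_ge0 r_le].
have := word_sum_ge0 b v; have := word_sum_tail_le b v.
have : 0 <= residual b x v * lam ^+ size v by rewrite mulr_ge0 // ltW.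
have : residual b x v * lam ^+ size v <= max_sum lam * lam ^+ size v.
  by rewrite ler_pM2r.
by have := residualK b x v; lra.
Qed.

Lemma dist_le_residual b x y v :
  0 <= residual b x v <= max_sum lam -> 0 <= residual b y v <= max_sum lam ->
  `|x - y| <= max_sum lam * lam ^+ size v.
Proof.
have pow_gt0 : 0 < lam ^+ size v by rewrite exprn_gt0.
move=> /andP[? ?] /andP[? ?]; rewrite -(residualK b x v) -(residualK b y v).
rewrite opprD addrACA subrr add0r -mulrBl normrM (gtr0_norm pow_gt0).
by rewrite ler_pM2r // ler_norml; apply/andP; split; lra.
Qed.

Lemma total_gt0 h b n x : 0 < total h b n x ->
  exists v : n.-tuple bool, 0 < h (residual b x v).
Proof.
move=> total0; apply/existsP; apply: contraTT total0 => /existsPn h_le0.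
by rewrite -leNgt sumr_le0 // => v _; rewrite leNgt.
Qed.

Lemma total_le h h' m b n x y :
  (forall r s, `|r - s| <= m -> h r <= h' s) ->
  `|x - y| <= m * lam ^+ n -> total h b n x <= total h' b n y.
Proof.
move=> hh' xy; apply: ler_sum => v _; apply: hh'.
rewrite /residual size_tuple -mulrBl opprD addrACA subrr addr0.
have pow_gt0 : 0 < lam ^+ n by rewrite exprn_gt0.
by rewrite normrM normfV (gtr0_norm pow_gt0) ler_pdivrMr.
Qed.

Definition total_weight b n : R -> R := total (weight lam) b n.

Definition total_inner_weight b n : R -> R := total (inner_weight lam) b n.

Lemma total_inner_weight_le b n x y : `|x - y| <= margin lam * lam ^+ n ->
  total_inner_weight b n x <= total_weight b n y.
Proof. by apply: total_le; exact: inner_weight_le. Qed.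

End WordSums.

Section HeavyPoint.
Variables (R : archiRealFieldType) (lam : R).
Hypotheses (lam_gt0 : 0 < lam) (lam_lt1 : lam < 1).
Hypothesis golden : 1 < lam + lam ^+ 2.

Lemma heavy_grid_point b (v : seq bool) :
  exists2 j, (j < (Num.truncn (4 * max_sum lam / lam ^+ size v)).+1)%N &
    1 / 4 <= inner_weight lam (residual lam b (j%:R / 4 * lam ^+ size v) v).
Proof.
have pow_gt0 : 0 < lam ^+ size v by rewrite exprn_gt0.
have max_sum_gt0 := max_sum_gt0 lam_gt0 lam_lt1.
pose q := word_sum lam b v / lam ^+ size v.
have q_ge0 : 0 <= q by rewrite divr_ge0 ?word_sum_ge0 // ltW.
have q_le : q + max_sum lam <= max_sum lam / lam ^+ size v.
  by rewrite ler_pdivlMr // mulrDl divfK ?gt_eqF // word_sum_tail_le.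
pose c := 4 * (q + max_sum lam / 2).
have : 0 <= c by rewrite mulr_ge0 // addr_ge0 // ltW // divr_gt0.
move=> /truncn_itv/andP[trunc_le]; rewrite -natr1 => lt_trunc.
exists (Num.truncn c).
  by rewrite ltnS le_truncn // /c -mulrA ler_pM2l //; lra.
apply: inner_weight_center => //.
rewrite /c in trunc_le lt_trunc *.
rewrite /residual mulrBl mulfK ?gt_eqF // -/q ler_norml.
by apply/andP; split; lra.
Qed.

Definition heavy_scale : R := 4 * (4 * max_sum lam + 1).

Lemma heavy_scale_gt0 : 0 < heavy_scale.
Proof. by have := max_sum_gt0 lam_gt0 lam_lt1; rewrite /heavy_scale; lra. Qed.

(* Averaging over a grid of spacing [lam ^+ m / 4]: its [O(lam ^- m)] points in
   [[0, max_sum]] carry a total weight of order [2 ^ m]. *)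
Lemma heavy_point b m : exists2 y, 0 <= y &
  (2 * lam) ^+ m / heavy_scale <= total_inner_weight lam b m y.
Proof.
have pow_gt0 : 0 < lam ^+ m by rewrite exprn_gt0.
have max_sum_gt0 := max_sum_gt0 lam_gt0 lam_lt1.
pose N := (Num.truncn (4 * max_sum lam / lam ^+ m)).+1.
have N_le : N%:R * lam ^+ m <= 4 * max_sum lam + 1.
  rewrite /N -natr1 mulrDl mul1r lerD //; last first.
    by rewrite exprn_ile1 ?(ltW lam_gt0) ?(ltW lam_lt1).
  by rewrite -ler_pdivlMr // truncn_le ltW // divr_gt0 // mulr_gt0.
pose y (j : 'I_N) := j%:R / 4 * lam ^+ m.
have [||j le_y] := @exists_ge_average _ 'I_N
    (fun j => total_inner_weight lam b m (y j)) (2 ^+ m / 4 / N%:R).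
- by rewrite card_ord.
- rewrite card_ord divfK ?pnatr_eq0 // exchange_big /=.
  rewrite (_ : 2 ^+ m / 4 = \sum_(v : m.-tuple bool) (1 / 4)); last first.
    by rewrite sumr_const card_tuple card_bool -[RHS]mulr_natl natrX mul1r.
  apply: ler_sum => v _; have [j] := heavy_grid_point b v.
  rewrite size_tuple => jN heavy_j; rewrite (bigD1 (Ordinal jN)) //=.
  by rewrite ler_wpDr // sumr_ge0 // => i _; exact: clipped_tent_ge0.
exists (y j); first by rewrite mulr_ge0 ?divr_ge0 ?(ltW pow_gt0).
rewrite (le_trans _ le_y) // exprMn ler_pdivrMr ?heavy_scale_gt0 //.
have N_gt0 : 0 < N%:R :> R by rewrite ltr0n.
have -> : 2 ^+ m / 4 / N%:R * heavy_scale =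
    2 ^+ m * ((4 * max_sum lam + 1) / N%:R).
  by rewrite /heavy_scale; field; rewrite gt_eqF.
by rewrite ler_pM2l ?exprn_gt0 // ler_pdivlMr // mulrC.
Qed.

End HeavyPoint.

(** * Probability that the total weight fails to grow *)

Section Failure.
Variables (d : measure_display) (T : measurableType d) (R : realType).
Variables (P : probability T R) (a : seq bool -> T -> bool) (lam : R).
Hypothesis iid : iid_fair_labels P a.
Hypotheses (lam_gt0 : 0 < lam) (lam_lt1 : lam < 1).
Hypothesis golden : 1 < lam + lam ^+ 2.

Local Notation short_word n := {v : n.-bseq bool | (0 < size v)%N}.
Local Notation child n := (n.-tuple bool * bool)%type.

Definition growth_rate : R := 1 + slack lam / 8.

Lemma growth_rate_gt1 : 1 < growth_rate.
Proof. by rewrite ltrDl divr_gt0 // slack_gt0. Qed.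

Definition failure_rate : R := (slack lam / 16) ^+ 2 / 4.

Lemma failure_rate_gt0 : 0 < failure_rate.
Proof. by rewrite divr_gt0 // exprn_gt0 // divr_gt0 // slack_gt0. Qed.

Definition child_weight b n x (p : child n) (c : bool) : R :=
  inner_weight lam (residual lam b x p.1 / lam - c%:R).

Lemma uniform_mean_child_weight b n x :
  (1 + slack lam / 4) * total_weight lam b n x <=
  uniform_mean (@child_weight b n x).
Proof.
rewrite /total_weight /total mulr_sumr /uniform_mean.
rewrite -(pair_bigA _ (fun (v : n.-tuple bool) i =>
  (\sum_c child_weight b x (v, i) c) / #|{: bool}|%:R)) /=.
apply: ler_sum => v _; rewrite !big_bool card_bool /child_weight /= subr0.
by have := weight_growth lam_gt0 lam_lt1 golden (residual lam b x v); lra.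
Qed.

Lemma card_child_weight_lt b n x z : 0 <= z -> z <= total_weight lam b n x ->
  #|[pred c : {ffun child n -> bool} |
     \sum_p child_weight b x p (c p) < growth_rate * z]|%:R <=
  expR (- (failure_rate * z)) * 2 ^+ #|{: child n}|.
Proof.
move=> z_ge0 z_le; have mean_ge := uniform_mean_child_weight b n x.
set g := @child_weight b n x in mean_ge *.
have slack_gt0 := slack_gt0 lam_lt1 golden.
have [slack_lt _ _] := slack_bounds lam_gt0 golden.
have sz_ge0 : 0 <= slack lam * z by rewrite mulr_ge0 // ltW.
have z_growth : (1 + slack lam / 4) * z <= uniform_mean g.
  by rewrite (le_trans _ mean_ge) // ler_wpM2l //; lra.
have z_le_mean : z <= uniform_mean g by lra.
pose tau := slack lam / 16.
have tau01 : 0 <= tau <= 1 by apply/andP; rewrite /tau; lra.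
have rate_le : growth_rate * z <= (1 - tau) * uniform_mean g.
  have : (1 - tau) * ((1 + slack lam / 4) * z) <= (1 - tau) * uniform_mean g.
    by rewrite ler_wpM2l //; lra.
  have : slack lam * (slack lam * z) <= 1 / 8 * (slack lam * z).
    by rewrite ler_wpM2r // ltW.
  by rewrite /tau /growth_rate; lra.
apply: (@le_trans _ _ (#|[pred c : {ffun child n -> bool} |
     \sum_p g p (c p) < (1 - tau) * uniform_mean g]|%:R)).
  rewrite ler_nat; apply/subset_leq_card/fintype.subsetP => c; rewrite !inE.
  by move=> /lt_le_trans; apply.
apply: le_trans (card_chernoff _ tau01 _) _ => [|p c|].
- by rewrite card_bool.
- exact: inner_weight_bounds.
- rewrite card_bool ler_pM2r ?exprn_gt0 // ler_expR lerN2 -/failure_rate.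
  by rewrite ler_pM2l // failure_rate_gt0.
Qed.

Definition failure n x z : set T :=
  [set t | z <= total_weight lam (a ^~ t) n x /\
           total_inner_weight lam (a ^~ t) n.+1 x < growth_rate * z].

(* The words whose labels decide [failure n]: those of length at most [n], on
   which the Chernoff bound is conditioned, and the children of level [n]. *)
Definition labelled_word n (j : short_word n + child n) : seq bool :=
  match j with inl v => val (val v) | inr p => rcons p.1 p.2 end.

Lemma labelled_word_gt0 n j : (0 < size (@labelled_word n j))%N.
Proof. by case: j => [[]|p] //=; rewrite size_rcons. Qed.

Lemma labelled_word_inj n : injective (@labelled_word n).
Proof.
move=> [v|[v i]] [w|[w j]] /=.
- by move=> /val_inj/val_inj ->.
- move=> vw; have := size_bseq (val v).
  by rewrite vw size_rcons size_tuple ltnn.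
- move=> vw; have := size_bseq (val w).
  by rewrite -vw size_rcons size_tuple ltnn.
- by move=> /rcons_inj[/val_inj -> ->].
Qed.

Definition failing_outcome n x z (f : {ffun short_word n -> bool})
    (c : {ffun child n -> bool}) : bool :=
  let b := extend (@labelled_word n \o inl) f in
  (z <= total_weight lam b n x) &&
  (\sum_p child_weight b x p (c p) < growth_rate * z).

Lemma failureE n x z (w := @labelled_word n) : failure n x z =
  [set t | failing_outcome x z
    (outcome a (w \o inl) t) (outcome a (w \o inr) t)].
Proof.
have inl_injective : injective (w \o inl).
  exact: inj_comp (@labelled_word_inj n) (@inl_inj _ _).
pose past t := extend (w \o inl) (outcome a (w \o inl) t).
have pastE t v : (0 < size v <= n)%N -> a v t = past t v.
  move=> /andP[v_gt0 v_le].
  pose j : short_word n := exist _ (Bseq v_le) v_gt0.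
  by have := extendE (outcome a (w \o inl) t) j inl_injective; rewrite ffunE.
have weightE t : total_weight lam (a ^~ t) n x = total_weight lam (past t) n x.
  by apply: eq_total; exact: pastE.
have childE t : total_inner_weight lam (a ^~ t) n.+1 x =
    \sum_p child_weight (past t) x p (outcome a (w \o inr) t p).
  rewrite /total_inner_weight total_rcons //; apply: eq_bigr => p _.
  rewrite ffunE; congr (inner_weight lam (_ / lam - _)).
  by apply: eq_residual => v; rewrite size_tuple; exact: pastE.
rewrite /failure /failing_outcome; apply/seteqP.
by split=> t /=; rewrite childE weightE => /andP.
Qed.

Lemma measurable_failure n x z : measurable (failure n x z).
Proof.
rewrite failureE.
exact: (measurable_outcome_pair iid _ _ (fun f c => failing_outcome x z f c)).
Qed.

Lemma failure_prob_le n x z : 0 <= z ->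
  (P (failure n x z) <= (expR (- (failure_rate * z)))%:E)%E.
Proof.
move=> z_ge0; rewrite failureE.
apply: (prob_conditional_le (A := failing_outcome x z) iid
  (@labelled_word_inj n) (@labelled_word_gt0 n)) => f.
set b := extend (@labelled_word n \o inl) f.
have [z_le|z_gt] := leP z (total_weight lam b n x).
  have := card_child_weight_lt z_ge0 z_le; congr (_%:R <= _).
  by apply: eq_card => c; rewrite !inE /failing_outcome -/b z_le.
rewrite eq_card0 ?mulr_ge0 ?expR_ge0 ?exprn_ge0 // => c.
by rewrite inE /failing_outcome -/b leNgt z_gt.
Qed.

End Failure.

(** * The set of sums *)

Local Notation prefix := Defs.prefix.

Section Prefix.
Implicit Types (omega : nat -> bool) (v : seq bool).

Lemma size_prefix omega n : size (prefix omega n) = n.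
Proof. by rewrite size_map size_iota. Qed.

Lemma prefixD omega n k :
  prefix omega (n + k) = prefix omega n ++ prefix (fun i => omega (n + i)%N) k.
Proof.
rewrite /prefix iotaD map_cat add0n; congr (_ ++ _).
by rewrite -{1}[n]addn0 iotaDl -map_comp.
Qed.

Lemma prefixS omega n : prefix omega n.+1 = rcons (prefix omega n) (omega n).
Proof. by rewrite -addn1 prefixD cats1 /= addn0. Qed.

Definition glue v omega : nat -> bool :=
  fun i => if (i < size v)%N then nth false v i else omega (i - size v)%N.

Lemma prefix_glue v omega : prefix (glue v omega) (size v) = v.
Proof.
apply: (@eq_from_nth _ false); rewrite size_prefix // => i iv.
by rewrite (nth_map 0%N) ?size_iota // nth_iota // add0n /glue iv.
Qed.

Lemma glueD v omega : (fun i => glue v omega (size v + i)%N) = omega.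
Proof. by apply/funext => i; rewrite /glue ltnNge leq_addr /= addKn. Qed.

End Prefix.

Section Support.
Variables (R : realType) (T : Type) (lam : R).
Hypotheses (lam_gt0 : 0 < lam) (lam_lt1 : lam < 1).
Implicit Types (a : seq bool -> T -> bool) (t : T) (omega : nat -> bool).

Lemma exists_max_sum_expr_lt e : 0 < e -> exists n, max_sum lam * lam ^+ n < e.
Proof. by move=> e_gt0; apply: exists_mul_expr_lt; rewrite ?gtr0_norm. Qed.

Lemma residual_continuous b v : continuous (residual lam b ^~ v).
Proof. by move=> x; apply: cvgMl; apply: cvgB => //; exact: cvg_cst. Qed.

Lemma series_word_sum a t omega n :
  series (fun j : nat => (a (prefix omega j.+1) t)%:R * lam ^+ j.+1) n =
  word_sum lam (a ^~ t) (prefix omega n).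
Proof.
elim: n => [|n IH]; first by rewrite /series /= big_geq // word_sum_nil.
by rewrite seriesSr IH prefixS word_sum_rcons size_prefix.
Qed.

Lemma fbin_cvg a t omega :
  word_sum lam (a ^~ t) (prefix omega n) @[n --> \oo] --> fbin a lam t omega.
Proof.
rewrite -(eq_cvg _ _ (series_word_sum a t omega)) /fbin.
apply: nondecreasing_is_cvgn.
  apply/nondecreasing_seqP => n; rewrite seriesSr lerDl.
  by rewrite mulr_ge0 // exprn_ge0 // ltW.
by exists (max_sum lam) => _ [n _ <-]; rewrite series_word_sum word_sum_le.
Qed.

Lemma fbin_bounds a t omega : 0 <= fbin a lam t omega <= max_sum lam.
Proof.
have sum_cvg := @fbin_cvg a t omega; apply/andP; split.
  by apply: (cvgr_to_ge sum_cvg); apply: nearW => n; exact: word_sum_ge0.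
by apply: (cvgr_to_le sum_cvg); apply: nearW => n; exact: word_sum_le.
Qed.

Lemma residual_fbin a t omega n :
  residual lam (a ^~ t) (fbin a lam t omega) (prefix omega n) =
  fbin (fun u => a (prefix omega n ++ u)) lam t (fun i => omega (n + i)%N).
Proof.
set a' := fun u => a _; set omega' := fun i => omega _.
pose sums k := word_sum lam (a ^~ t) (prefix omega (n + k)).
pose tails k := residual lam (a ^~ t) (sums k) (prefix omega n).
have tails_fbin : tails k @[k --> \oo] --> fbin a' lam t omega'.
  have tailsE k : tails k = word_sum lam (a' ^~ t) (prefix omega' k).
    rewrite /tails /sums prefixD word_sum_cat [X in _ + X]mulrC.
    exact: residual_affine.
  by rewrite (eq_cvg _ _ tailsE); exact: fbin_cvg.
have tails_residual : tails k @[k --> \oo] -->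
    residual lam (a ^~ t) (fbin a lam t omega) (prefix omega n).
  have sums_cvg := cvg_comp _ _ (@cvg_addnl n) (@fbin_cvg a t omega).
  exact: (cvg_comp _ _ sums_cvg (@residual_continuous (a ^~ t) _ _)).
exact: (cvg_unique (@Rhausdorff R) tails_residual tails_fbin).
Qed.

Lemma fbin_glue a t v omega :
  residual lam (a ^~ t) (fbin a lam t (glue v omega)) v =
  fbin (fun u => a (v ++ u)) lam t omega.
Proof.
have := residual_fbin a t (glue v omega) (size v).
by rewrite prefix_glue glueD.
Qed.

Lemma residual_fbin_bounds a t omega n :
  0 <= residual lam (a ^~ t) (fbin a lam t omega) (prefix omega n)
    <= max_sum lam.
Proof. by rewrite residual_fbin fbin_bounds. Qed.

Lemma fbin_continuous a t : continuous (fbin a lam t : cantor_space -> R).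
Proof.
move=> omega; apply/cvgrPdist_lt => e e_gt0.
have [n n_small] := exists_max_sum_expr_lt e_gt0.
pose agree (i : 'I_n) (omega' : cantor_space) := omega' i = omega i.
have : nbhs omega [set omega' | forall i, agree i omega'].
  apply: (filter_forall (nbhs_filter omega)) => i.
  exact: (@proj_continuous nat (fun=> bool) i omega _ (discrete_set1 _)).
apply: filterS => omega' omega'_agree.
have prefixE : prefix omega' n = prefix omega n.
  apply/eq_in_map => i; rewrite mem_iota => i_lt.
  exact: (omega'_agree (Ordinal i_lt)).
apply: le_lt_trans n_small; rewrite -[X in lam ^+ X](size_prefix omega n).
apply: (dist_le_residual lam_gt0 (b := a ^~ t)).
  exact: residual_fbin_bounds.
by rewrite -prefixE; exact: residual_fbin_bounds.
Qed.

Lemma Sbin_closed a t : closed (Sbin a lam t).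
Proof.
apply: compact_closed; first exact: Rhausdorff.
apply: (@continuous_compact cantor_space); last exact: cantor_space_compact.
exact/continuous_subspaceT/fbin_continuous.
Qed.

Lemma Sbin_of_residual a t x :
  (forall N, exists2 v : seq bool, (N <= size v)%N &
     0 <= residual lam (a ^~ t) x v <= max_sum lam) ->
  Sbin a lam t x.
Proof.
move=> x_residual; apply: Sbin_closed => B.
rewrite -nbhs_ballE => -[e /= e_gt0 eB].
have [N N_small] := exists_max_sum_expr_lt e_gt0.
have [v N_le xv] := x_residual N.
exists (fbin a lam t (glue v xpredT)); split; first by exists (glue v xpredT).
apply: eB; rewrite /ball /=.
apply: le_lt_trans (dist_le_residual lam_gt0 xv _) _.
  by rewrite fbin_glue fbin_bounds.
apply: le_lt_trans N_small.
by rewrite ler_pM2l ?max_sum_gt0 // ler_wiXn2l // ltW.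
Qed.

Lemma interior_Sbin_residual a t v x :
  interior (Sbin (fun u => a (v ++ u)) lam t) (residual lam (a ^~ t) x v) ->
  interior (Sbin a lam t) x.
Proof.
move=> residual_int; have := @residual_continuous (a ^~ t) v x _ residual_int.
apply: (@filterS _ (nbhs x)) => z [omega _ fE].
exists (glue v omega) => //.
by rewrite -[LHS](residualK lam_gt0 (a ^~ t) _ v) fbin_glue fE residualK.
Qed.

Lemma Sbin_regular a t :
  (forall v, interior (Sbin (fun u => a (v ++ u)) lam t) !=set0) ->
  Sbin a lam t = closure (interior (Sbin a lam t)).
Proof.
move=> int_nonempty; apply/seteqP; split; last first.
  have := closureS (@interior_subset _ (Sbin a lam t)).
  by rewrite -((closure_id _).1 (@Sbin_closed a t)).
move=> _ [omega _ <-] B; rewrite -nbhs_ballE => -[e /= e_gt0 eB].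
have [n n_small] := exists_max_sum_expr_lt e_gt0.
have [y y_int] := int_nonempty (prefix omega n).
set v := prefix omega n in y_int.
pose x := word_sum lam (a ^~ t) v + y * lam ^+ size v.
have xE : residual lam (a ^~ t) x v = y by exact: residual_affine.
exists x; split; first by apply: (@interior_Sbin_residual _ _ v); rewrite xE.
apply: eB; rewrite /ball /=; apply: le_lt_trans n_small.
rewrite -[X in lam ^+ X](size_prefix omega n).
apply: (dist_le_residual lam_gt0 (b := a ^~ t)).
  exact: residual_fbin_bounds.
by rewrite xE; have [omega' _ <-] := interior_subset y_int; exact: fbin_bounds.
Qed.

End Support.

(** * Almost sure interior *)

Section AlmostSureInterior.
Variables (d : measure_display) (T : measurableType d) (R : realType).
Variables (P : probability T R) (a : seq bool -> T -> bool) (lam : R).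
Hypothesis iid : iid_fair_labels P a.
Hypotheses (lam_gt0 : 0 < lam) (lam_lt1 : lam < 1).
Hypothesis golden : 1 < lam + lam ^+ 2.

Definition threshold n : R := growth_rate lam ^+ n / heavy_scale lam.

Definition spacing n : R := margin lam / 2 ^+ n.

Definition grid_size n : nat := (Num.truncn (max_sum lam / spacing n)).+1.

Definition failures n : set T := \big[setU/set0]_(j < grid_size n.+1)
  failure a lam n (j%:R * spacing n.+1) (threshold n).

Lemma threshold_gt0 n : 0 < threshold n.
Proof.
rewrite divr_gt0 ?heavy_scale_gt0 // exprn_gt0 //.
by rewrite (lt_trans ltr01) // growth_rate_gt1.
Qed.

Lemma thresholdS n : threshold n.+1 = growth_rate lam * threshold n.
Proof. by rewrite /threshold exprS mulrA. Qed.

Lemma threshold_le n : threshold n <= (2 * lam) ^+ n / heavy_scale lam.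
Proof.
rewrite ler_pM2r ?invr_gt0 ?heavy_scale_gt0 //.
have [slack_lt _ _] := slack_bounds lam_gt0 golden.
have slack_gt0 := slack_gt0 lam_lt1 golden.
have lam_ge : 3 / 5 <= lam.
  by have := golden; have := lam_gt0; rewrite expr2; nra.
by rewrite /growth_rate; apply: lerXn2r; rewrite ?nnegrE; lra.
Qed.

Lemma spacing_gt0 n : 0 < spacing n.
Proof. by rewrite divr_gt0 ?exprn_gt0 // margin_gt0. Qed.

Lemma spacingD n k : spacing n = (2 ^ k)%:R * spacing (n + k).
Proof. by rewrite /spacing natrX exprD; field; rewrite !expf_neq0. Qed.

Lemma spacing_le n : spacing n <= margin lam * lam ^+ n.
Proof.
rewrite ler_pM2l ?margin_gt0 // -exprVn.
rewrite lerXn2r ?nnegrE ?invr_ge0 ?(ltW lam_gt0) //.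
by have := lam_gt_half lam_gt0 golden; lra.
Qed.

Lemma grid_size_le n :
  (grid_size n)%:R <= (max_sum lam / margin lam + 1) * 2 ^+ n.
Proof.
rewrite /grid_size -natr1 mulrDl mul1r lerD ?exprn_ege1 ?ler1n //.
have -> : max_sum lam / margin lam * 2 ^+ n = max_sum lam / spacing n.
  by rewrite /spacing; field; rewrite expf_neq0 //= gt_eqF ?margin_gt0.
by rewrite truncn_le ltW // divr_gt0 ?(max_sum_gt0 lam_gt0) ?spacing_gt0.
Qed.

Lemma measurable_failures n : measurable (failures n).
Proof.
by apply: bigsetU_measurable => j _; exact: (measurable_failure iid lam_gt0).
Qed.

Lemma failures_prob_le n : (P (failures n) <=
  ((grid_size n.+1)%:R * expR (- (failure_rate lam * threshold n)))%:E)%E.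
Proof.
apply: le_trans (measure_bigsetU_le _ _ _ _) _ => [j|].
  exact: (measurable_failure iid lam_gt0).
apply: (@le_trans _ _ (\sum_(j < grid_size n.+1)
    (expR (- (failure_rate lam * threshold n)))%:E)%E).
  apply: lee_sum => j _; apply: (failure_prob_le iid) => //.
  exact/ltW/threshold_gt0.
by rewrite sumEFin sumr_const card_ord mulr_natl.
Qed.

Lemma failures_summable : (\sum_(n <oo) P (failures n) < +oo)%E.
Proof.
pose A := max_sum lam / margin lam + 1; pose q := growth_rate lam.
pose c := failure_rate lam / heavy_scale lam.
have A_gt0 : 0 < A.
  by rewrite addr_gt0 // divr_gt0 ?(max_sum_gt0 lam_gt0) ?margin_gt0.
have c_gt0 : 0 < c by rewrite divr_gt0 ?failure_rate_gt0 ?heavy_scale_gt0.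
have q_gt1 : 1 < q by exact: growth_rate_gt1.
have [C C_bound] := expr_mul_expR_bounded (ler0n _ 4) q_gt1 c_gt0.
apply: (@le_lt_trans _ _
    (\sum_(0 <= n <oo) (4 * A * C / (2 ^ (n + 1))%:R)%:E)%E); last first.
  by rewrite (cvg_lim _ (@cvg_geometric_eseries_half R (4 * A * C) 0)) // ltry.
apply: lee_nneseries => [n _ _|n _]; first exact: measure_ge0.
apply: le_trans (failures_prob_le n) _; rewrite lee_fin.
apply: le_trans (ler_wpM2r (expR_ge0 _) (grid_size_le _)) _.
have -> : failure_rate lam * threshold n = c * q ^+ n.
  by rewrite /threshold /c mulrA mulrAC.
have half_bound : 2 ^+ n * expR (- (c * q ^+ n)) <= C / 2 ^+ n.
  by rewrite ler_pdivlMr ?exprn_gt0 // mulrAC -exprMn -natrM; exact: C_bound.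
have -> : 4 * A * C / (2 ^ (n + 1))%:R = A * (2 * (C / 2 ^+ n)).
  by rewrite natrX addn1 exprS; field; rewrite expf_neq0.
by rewrite -/A exprS -mulrA ler_pM2l // -mulrA ler_pM2l.
Qed.

Lemma lim_sup_failures : P (lim_sup_set failures) = 0%E.
Proof. exact: lim_sup_set_cvg0 measurable_failures failures_summable. Qed.

(* The point [grid_floor _ x] lies in the finite grid because positivity of its
   weight puts it in [[0, max_sum]]. *)
Lemma total_weight_step t n x (y := grid_floor (spacing n.+1) x) :
  ~ failures n t -> 0 <= x -> threshold n <= total_weight lam (a ^~ t) n y ->
  threshold n.+1 <= total_weight lam (a ^~ t) n.+1 x.
Proof.
move=> no_failure x_ge0 y_heavy; have e_gt0 := spacing_gt0 n.+1.
have /andP[y_le x_lt] := grid_floor_itv e_gt0 x_ge0.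
have [v] := total_gt0 (lt_le_trans (threshold_gt0 n) y_heavy).
move=> /(weight_gt0_bounds lam_lt1 golden).
move=> /(residual_bounds lam_gt0 lam_lt1)/andP[_ y_max].
have y_grid : (Num.truncn (x / spacing n.+1) < grid_size n.+1)%N.
  rewrite ltnS truncn_ge_nat; last by rewrite ltW // divr_gt0 // max_sum_gt0.
  by rewrite ler_pdivlMr.
have inner_heavy : threshold n.+1 <= total_inner_weight lam (a ^~ t) n.+1 y.
  rewrite leNgt thresholdS; apply/negP => light; apply: no_failure.
  rewrite /failures -(@bigcup_mkord _ _ (fun j => failure a lam n
    (j%:R * spacing n.+1) (threshold n))).
  by exists (Num.truncn (x / spacing n.+1)).
apply: le_trans inner_heavy (total_inner_weight_le _ _ _) => //.
apply: le_trans (spacing_le _); rewrite distrC ger0_norm ?subr_ge0 //.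
by rewrite lerBlDl ltW.
Qed.

Section NoFailure.
Variables (t : T) (m : nat).
Hypothesis no_failure : forall n, (m <= n)%N -> ~ failures n t.

(* The left end is a grid point of level [m], hence of all later levels, so that
   rounding down never leaves the interval. *)
Lemma total_weight_propagation (x0 q : R) (p := grid_floor (spacing m) x0) :
  0 <= x0 ->
  (forall x, p <= x <= q -> threshold m <= total_weight lam (a ^~ t) m x) ->
  forall k x, p <= x <= q ->
    threshold (m + k) <= total_weight lam (a ^~ t) (m + k) x.
Proof.
move=> x0_ge0 heavy.
have p_ge0 : 0 <= p by rewrite mulr_ge0 // ltW // spacing_gt0.
elim=> [|k IH] x /andP[p_le x_le].
  by rewrite addn0; apply: heavy; rewrite p_le.
have x_ge0 := le_trans p_ge0 p_le.
have /andP[y_le _] := grid_floor_itv (spacing_gt0 (m + k).+1) x_ge0.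
rewrite addnS; apply: total_weight_step => //; first exact/no_failure/leq_addr.
apply: IH; rewrite (le_trans y_le x_le) andbT.
move: p_le; rewrite /p (spacingD m k.+1) addnS.
by apply: grid_floor_refine; rewrite ?expn_gt0 ?spacing_gt0.
Qed.

Lemma interior_Sbin_nonempty : interior (Sbin a lam t) !=set0.
Proof.
have [x0 x0_ge0 x0_heavy] := heavy_point lam_gt0 lam_lt1 golden (a ^~ t) m.
pose r := margin lam * lam ^+ m.
have r_gt0 : 0 < r by rewrite mulr_gt0 ?exprn_gt0 // margin_gt0.
have := grid_floor_itv (spacing_gt0 m) x0_ge0; set p := grid_floor _ _.
move=> /andP[p_le x0_lt].
have heavy x : p <= x <= x0 + r ->
    threshold m <= total_weight lam (a ^~ t) m x.
  move=> /andP[p_x x_q]; apply: le_trans (threshold_le m) _.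
  apply: le_trans x0_heavy _; apply: total_inner_weight_le => //.
  by have := spacing_le m; rewrite -/r ler_norml => ?; apply/andP; split; lra.
exists (x0 + r / 2); suff : `]p, x0 + r[%classic `<=` Sbin a lam t.
  rewrite open_subsetE; last exact: interval_open.
  by apply; rewrite /= in_itv /=; apply/andP; split; lra.
move=> x; rewrite /= in_itv /= => /andP[/ltW p_x /ltW x_q].
apply: Sbin_of_residual => // N.
have := total_weight_propagation x0_ge0 heavy N; rewrite -/p => /(_ x).
rewrite p_x x_q => /(_ isT)/(lt_le_trans (threshold_gt0 _))/total_gt0[v v_gt0].
by exists v; [rewrite size_tuple leq_addl|exact: weight_gt0_bounds v_gt0].
Qed.

End NoFailure.

Lemma ae_interior_Sbin : {ae P, forall t, interior (Sbin a lam t) !=set0}.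
Proof.
exists (lim_sup_set failures); split; [|exact: lim_sup_failures|].
  apply: bigcap_measurable => // n _; apply: bigcup_measurable => k _.
  exact: measurable_failures.
move=> t /= empty_int m _; apply: contrapT => no_failure; apply: empty_int.
apply: (@interior_Sbin_nonempty t m) => n m_le fails.
by apply: no_failure; exists n.
Qed.

End AlmostSureInterior.

Lemma golden_ratio_lt (R : rcfType) (x : R) :
  (Num.sqrt 5 - 1) / 2 < x -> 0 < x /\ 1 < x + x ^+ 2.
Proof.
move=> x_gt; have sqr5 : Num.sqrt 5 ^+ 2 = 5 :> R by rewrite sqr_sqrtr.
have sqrt5_gt1 : 1 < Num.sqrt 5 :> R.
  by have := sqrtr_ge0 (5 : R); move: sqr5; rewrite expr2; nra.
by move: sqr5; rewrite !expr2; split; nra.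
Qed.

Lemma iid_fair_labels_cat d (T : measurableType d) (R : realType)
    (P : probability T R) (a : seq bool -> T -> bool) (v : seq bool) :
  iid_fair_labels P a -> iid_fair_labels P (fun u => a (v ++ u)).
Proof.
move=> [mes_a prob_a]; split=> [u|s b s_uniq s_gt0]; first exact: mes_a.
have cat_inj : injective (cat v).
  by move=> u w /eqP; rewrite eqseq_cat // eqxx => /eqP.
have := prob_a [seq v ++ u | u <- s] (fun w => b (drop (size v) w)).
rewrite map_inj_uniq // all_map size_map => <- //; last first.
  by apply/allP => u /(allP s_gt0) /= u_gt0; rewrite size_cat ltn_addl.
congr (P _); apply/seteqP; split=> t labels_t /=.
  by move=> _ /mapP[u us ->] /=; rewrite drop_size_cat //; exact: labels_t.
move=> u us; have /= := labels_t (v ++ u).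
by rewrite drop_size_cat // => ->; rewrite ?map_f.
Qed.

Theorem theorem1p7 (d : measure_display) (T : measurableType d) (R : realType)
    (P : probability T R) (a : seq bool -> T -> bool) (lambda : R) :
  iid_fair_labels P a ->
  (Num.sqrt 5 - 1) / 2 < lambda < 1 ->
  {ae P, forall t, interior (Sbin a lambda t) !=set0 /\
                   Sbin a lambda t = closure (interior (Sbin a lambda t))}.
Proof.
move=> iid /andP[/golden_ratio_lt[lam_gt0 golden] lam_lt1].
have subtree_interior : {ae P, forall t, forall v,
    interior (Sbin (fun u => a (v ++ u)) lambda t) !=set0}.
  apply: ae_forall_countable => v.
  exact: (ae_interior_Sbin (iid_fair_labels_cat v iid) lam_gt0 lam_lt1 golden).
apply: filterS subtree_interior => t t_interior.
by split; [exact: (t_interior [::])|exact: Sbin_regular].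
Qed.
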